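(* Let $r\ge 1$ be an integer and $A$ a non-empty set of non-negative integers, both fixed. Choose integers $q$ and $i$ with $1\le q\le r$ and $0\le i\le r-q$ such that $f(q,i,A)^{1/q}$ is as large as possible, and suppose the maximum is attained at $q=p$ (with the corresponding $i$). Then, as $n\to\infty$, $g^{(r)}_A(n)=\Theta\big(f(p,i,A)^{n/p}\big)$.
   Context: An $r$-uniform hypergraph is a finite vertex set with a family of $r$-element subsets (hyperedges). A vertex is isolated if it lies in no hyperedge. A set $S$ of vertices is an $A$-transversal of an $r$-uniform hypergraph $\mathcal{H}$ if $|H\cap S|\in A$ for every hyperedge $H$. For $n\ge r$, $g^{(r)}_A(n)$ denotes the maximum number of $A$-transversals in an $r$-uniform hypergraph on $n$ vertices with no isolated vertices. For an integer $i\ge 0$, $A(i)=\{a-i: a\in A\}\cap\{0,1,2,\dots\}$, and $f(q,i,A)=\sum_{b\in A(i)}\binom{q}{b}$. The constants in $\Theta$ may depend on $r$ and $A$ but not on $n$. *)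

(* Defs.v *)
From HB Require Import structures.
From mathcomp Require Import all_boot all_order all_algebra.
From mathcomp Require Import all_classical all_reals all_analysis.

Set Implicit Arguments.
Unset Strict Implicit.
Unset Printing Implicit Defensive.

Import Order.TTheory GRing.Theory Num.Theory.

Local Open Scope classical_set_scope.
Local Open Scope ring_scope.

(* A hypergraph on the vertex type V is given by its set E of hyperedges. *)
Section Hypergraph.
Variable V : finType.
Implicit Types (E : {set {set V}}) (A : set nat) (S : {set V}).

Definition uniform (r : nat) E : bool := [forall H in E, #|H| == r].

Definition isolated E (v : V) : bool := [forall H in E, v \notin H].

Definition is_transversal_of (A : set nat) E S : bool :=
  [forall H in E, #|H :&: S| \in A].

Definition num_transversals (A : set nat) E : nat :=
  #|[set S : {set V} | is_transversal_of A E S]%SET|.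

End Hypergraph.

(* For n < r no hypergraph qualifies (unless n = 0) and the max defaults
   to 0; only the values at n >= r are meaningful. *)
Definition max_transversals (r : nat) (A : set nat) (n : nat) : nat :=
  (\max_(E : {set {set 'I_n}} |
      uniform r E && [forall v, ~~ isolated E v]) num_transversals A E)%N.

Definition shift_down (A : set nat) (i : nat) : set nat :=
  [set b : nat | exists2 a : nat, A a & b%:Z = a%:Z - i%:Z].

(* A may be infinite: this is a finitely supported sum, as 'C(q, b) = 0 for
   b > q (see fcountE). *)
Definition fcount (q i : nat) (A : set nat) : nat :=
  \big[addn/0%N]_(b \in shift_down A i) 'C(q, b).

Lemma shift_downE (A : set nat) (i b : nat) :
  (b \in shift_down A i) = ((b + i)%N \in A).
Proof.
apply/idP/idP => /set_mem; rewrite /shift_down /=.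
  case=> a Aa e; suff -> : (b + i)%N = a by exact: mem_set.
  by apply/eqP; rewrite -eqz_nat PoszD e subrK.
by move=> Abi; apply: mem_set; exists (b + i)%N => //; rewrite PoszD addrK.
Qed.

Lemma fcountE (q i : nat) (A : set nat) :
  fcount q i A = (\sum_(b < q.+1 | (b + i)%N \in A) 'C(q, b))%N.
Proof.
rewrite /fcount (fsbigE [seq b <- index_iota 0 q.+1 | b \in shift_down A i]).
- rewrite big_filter_cond big_mkord; apply: eq_bigl => b.
  by rewrite andbb shift_downE.
- by rewrite filter_uniq// iota_uniq.
- by move=> b; rewrite /mkset mem_filter => /andP[/set_mem].
- move=> b /mem_set Ab; rewrite mem_filter Ab mem_index_iota /= -leqNgt.
  exact: bin_small.
Qed.

(* Main.v *)
(* Upper bound: reveal a transversal one hyperedge at a time.  A hyperedge with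
   q vertices not seen before, whose already seen part meets the transversal in
   j vertices, allows f(q, j, A) <= f(p, i, A)^(q/p) extensions, so the product
   telescopes to f(p, i, A)^(n/p).
   Lower bound: glue disjoint blocks of p vertices to a common core of r - p
   vertices, and select i core vertices; each block then contributes a factor
   f(p, i, A) independently.  The remainder of n modulo p is absorbed by
   duplicating vertices. *)
Require Import Defs.
From mathcomp Require Import all_boot all_order all_algebra.
From mathcomp Require Import all_classical all_reals all_analysis.
From mathcomp Require Import fintype finset.

Import Order.TTheory GRing.Theory Num.Theory.

(** Links [fcount] to selections in both bounds: [D] will hold the still free vertices of a
    hyperedge, and [i] will count its vertices selected already. *)
Lemma card_subsets_fcount (T : finType) (D : {set T}) (A : set nat) (i : nat) :
  #|[set X : {set T} | X \subset D & (#|X| + i)%N \in A]%SET| =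
  fcount #|D| i A.
Proof.
rewrite fcountE -sum1_card.
rewrite (partition_big (fun X : {set T} => inord #|X| : 'I_#|D|.+1)
  (fun b : 'I_#|D|.+1 => (b + i)%N \in A)) /=; last first.
  by move=> X; rewrite inE => /andP[XD]; rewrite inordK // ltnS subset_leq_card.
apply: eq_bigr => b bA; rewrite sum1_card -cards_draws; apply: eq_card => X.
rewrite unfold_in !inE; case XD: (X \subset D) => //=.
rewrite -val_eqE /= inordK ?ltnS ?subset_leq_card //.
by case: eqP => [->|]; rewrite ?bA ?andbF.
Qed.

(** * Upper bound: revealing hyperedges one at a time *)

Section UpperBound.
Variables (R : realType) (V : finType) (A : set nat) (r : nat) (M : R).
Hypothesis M_ge0 : (0 <= M)%R.
Hypothesis fcount_le : forall q j : nat, (1 <= q <= r)%N -> (j <= r - q)%N ->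
  ((fcount q j A)%:R <= M ^+ q)%R.

Definition span_edges (s : seq {set V}) : {set V} := \bigcup_(H <- s) H.

Definition partial_transversals (s : seq {set V}) : {set {set V}} :=
  [set S : {set V} | (S \subset span_edges s) &&
     all (fun H : {set V} => #|H :&: S| \in A) s]%SET.

(** With [q = #|H :\: W|], an extension [S] of [S0] is determined by its trace on the [q] new
    vertices, and the size of this trace plus [#|H :&: S0|] lies in [A]. Since [S0] stays inside
    [W], that shift is at most [r - q], as [fcount_le] demands. *)
Lemma card_extensions_le (W H S0 : {set V}) : #|H| = r -> S0 \subset W ->
  (#|[set S : {set V} | [&& S \subset W :|: H, #|H :&: S| \in A &
      S :&: W == S0]]%SET|%:R <= M ^+ #|H :\: W|)%R.
Proof.
move=> Hr S0W; set X := [set S | _]%SET.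
have HS0 : #|H :&: S0| <= r - #|H :\: W|.
  rewrite -Hr -(cardsID W H) addnK; apply: subset_leq_card.
  exact: setIS.
have inj : {in X &, injective (fun S : {set V} => S :&: (H :\: W))}.
  move=> S S'; rewrite !inE => /and3P[sS _ /eqP e] /and3P[sS' _ /eqP e'] eq.
  have dec (Z : {set V}) : Z \subset W :|: H ->
      Z = (Z :&: W) :|: (Z :&: (H :\: W)).
    move=> ZWH; rewrite -setIUr; apply/esym/setIidPl; apply: (subset_trans ZWH).
    by apply/subsetP => x; rewrite !inE; case: (x \in W).
  by rewrite (dec S sS) (dec S' sS') e e' eq.
have sub : [set S :&: (H :\: W) | S in X]%SET \subset
    [set Y : {set V} | Y \subset H :\: W & (#|Y| + #|H :&: S0|)%N \in A]%SET.
  apply/subsetP => _ /imsetP[S + ->]; rewrite !inE subsetIr.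
  case/and3P=> _ HSA /eqP <-; move: HSA; rewrite -(cardsID W (H :&: S)) addnC.
  by rewrite setIDA [S :&: H]setIC setIA.
have := subset_leq_card sub; rewrite (card_in_imset inj) card_subsets_fcount.
(* [fcount_le] does not cover [q = 0]. Then every trace is empty, so at most one extension exists,
   and [M ^+ 0 = 1]. *)
move=> le; have [q0|q0] := posnP #|H :\: W|.
  rewrite q0 expr0 lern1 -(card_in_imset inj).
  apply: leq_trans (subset_leq_card (B := [set set0]%SET) _) _; last by rewrite cards1.
  apply/subsetP => _ /imsetP[S _ ->]; rewrite inE.
  by move/eqP: q0; rewrite cards_eq0 => /eqP ->; rewrite setI0.
apply: (@le_trans _ _ ((fcount #|H :\: W| #|H :&: S0| A)%:R)%R).
  by rewrite ler_nat.
apply: fcount_le => //; rewrite q0 -Hr subset_leq_card //.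
exact: subsetDl.
Qed.

Lemma card_partial_transversals_le (s : seq {set V}) :
  all (fun H : {set V} => #|H| == r) s ->
  (#|partial_transversals s|%:R <= M ^+ #|span_edges s|)%R.
Proof.
elim: s => [_|H s IH /= /andP[/eqP Hr sr]].
  rewrite /span_edges big_nil cards0 expr0 lern1.
  apply: leq_trans (subset_leq_card (B := [set set0]%SET) _) _; last by rewrite cards1.
  by apply/subsetP => S; rewrite !inE /span_edges big_nil subset0 => /andP[].
have spanE : span_edges (H :: s) = span_edges s :|: H.
  by rewrite /span_edges big_cons setUC.
set W := span_edges s in IH spanE *.
(* Group by the trace on [W]. Every hyperedge of [s] lies inside [W], so this trace is itself a
   partial transversal of [s], and each group consists of extensions of one trace. *)
rewrite -[#|partial_transversals _|]sum1_card (partition_big (fun S : {set V} => S :&: W)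
  [in partial_transversals s]) /=; last first.
  move=> S; rewrite !inE subsetIr /= => /andP[_ /andP[_ /allP sA]].
  apply/allP => K Ks; rewrite setIA setIAC -setIA [W :&: S]setIC.
  have KW : K \subset W by rewrite /W /span_edges bigcup_seq (bigcup_sup K).
  by rewrite [S :&: W]setIC setIA (setIidPl KW) sA.
rewrite natr_sum.
apply: (@le_trans _ _ (\sum_(S0 in partial_transversals s) M ^+ #|H :\: W|)%R).
  apply: ler_sum => S0; rewrite inE => /andP[S0W _].
  apply: le_trans (@card_extensions_le W H S0 Hr S0W).
  rewrite sum1_card ler_nat; apply: subset_leq_card; apply/subsetP => S.
  rewrite unfold_in !inE /= spanE => /andP[/andP[-> /andP[-> _]] ->] //.
rewrite sumr_const -mulr_natl.
have -> : #|span_edges (H :: s)| = #|W| + #|H :\: W|.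
  by rewrite spanE -(cardsID W) setUK setDUl setDv set0U.
by rewrite exprD ler_wpM2r ?exprn_ge0 ?IH.
Qed.

Lemma num_transversals_le (E : {set {set V}}) :
  uniform r E -> (forall v, ~~ Defs.isolated E v) ->
  ((num_transversals A E)%:R <= M ^+ #|V|)%R.
Proof.
move=> /forall_inP Er noniso.
(* As no vertex is isolated, the hyperedges cover [V], which turns the exponent into [#|V|]. *)
have EV : span_edges (enum E) = [set: V]%SET.
  apply/setP => v; rewrite inE; have := noniso v.
  rewrite negb_forall_in => /exists_inP[H HE]; rewrite negbK => vH.
  by rewrite /span_edges bigcup_seq; apply/bigcupP; exists H; rewrite ?mem_enum.
have /card_partial_transversals_le : all (fun H : {set V} => #|H| == r) (enum E).
  by apply/allP => H; rewrite mem_enum => /Er.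
rewrite EV cardsT; apply: le_trans; rewrite ler_nat; apply: subset_leq_card.
apply/subsetP => S; rewrite !inE EV subsetT => /forall_inP SA /=.
by apply/allP => H; rewrite mem_enum => /SA.
Qed.

End UpperBound.

(* Blow-up: pulling hyperedges and transversals back along a surjection from
   'I_n onto V preserves both. *)
Lemma num_transversals_le_max (V : finType) (r : nat) (A : set nat) (n : nat)
    (E : {set {set V}}) :
  uniform r E -> (forall v, ~~ Defs.isolated E v) -> 0 < #|V| <= n ->
  num_transversals A E <= max_transversals r A n.
Proof.
move=> /forall_inP Er noniso /andP[/card_gt0P[v0 _] Vn].
(* Indices from [#|V|] on fall back to the default, so [v0] is the only vertex duplicated. *)
pose f (j : 'I_n) := nth v0 (enum V) j.
have fK (v : V) : exists j, f j = v.
  have lt : index v (enum V) < n.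
    by rewrite (leq_trans _ Vn) // cardE index_mem mem_enum.
  by exists (Ordinal lt); rewrite /f nth_index ?mem_enum.
have [g gK] := choice fK.
(* The condition [#|H| == r] forces [f] to be injective on [H], because the image also has [r]
   elements; intersection sizes are therefore preserved. *)
pose E' := [set H : {set 'I_n} | (#|H| == r) && (f @: H \in E)].
have E'ok : uniform r E' && [forall v, ~~ Defs.isolated E' v].
  apply/andP; split.
    by apply/forall_inP => H; rewrite inE => /andP[].
  apply/forallP => u; rewrite negb_forall_in; have := noniso (f u).
  rewrite negb_forall_in => /exists_inP[H HE]; rewrite negbK => uH.
  (* A right inverse of [f] redirected through [u], so that the lift of a hyperedge containing [f u]
     contains [u] itself. *)
  pose h v := if v == f u then u else g v.
  have hK : cancel h f by move=> v; rewrite /h; case: eqP => [->|].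
  apply/exists_inP; exists (h @: H); last first.
    by rewrite negbK; apply/imsetP; exists (f u); rewrite // /h eqxx.
  rewrite inE (card_imset _ (can_inj hK)) (Er _ HE) /= -imset_comp.
  by rewrite (eq_imset (g := id)) ?imset_id // => v /=; rewrite hK.
rewrite /max_transversals.
apply: leq_trans (@leq_bigmax_cond _ _ (num_transversals A) E' E'ok).
rewrite /num_transversals.
have inj : injective (fun S : {set V} => f @^-1: S).
  move=> S S' /setP eq; apply/setP => v; have [j <-] := fK v.
  by have := eq j; rewrite !inE.
rewrite -(card_imset _ inj); apply: subset_leq_card; apply/subsetP.
move=> _ /imsetP[S + ->]; rewrite !inE => /forall_inP SA.
apply/forall_inP => H; rewrite inE => /andP[Hr HE].
have injH : {in H &, injective f}.
  by apply/imset_injP; rewrite (eqP (Er _ HE)) eq_sym.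
have := SA _ HE; congr (_ \in A).
have <- : f @: (H :&: f @^-1: S) = f @: H :&: S.
  apply/setP => v; rewrite inE; apply/imsetP/andP.
    by case=> j; rewrite !inE => /andP[jH jS] ->; rewrite imset_f.
  by case=> /imsetP[j jH ->] jS; exists j; rewrite // !inE jH.
rewrite card_in_imset // => x y; rewrite !inE => /andP[xH _] /andP[yH _].
exact: injH.
Qed.

(** * Lower bound: sunflowers *)

Section Sunflower.
Variables (m p c : nat).
Let V : finType := ('I_m * 'I_p + 'I_c)%type.

(** Arbitrary [X] and [C] are allowed so that a hyperedge and its trace on a selected set have the
    same form. *)
Definition petal (k : 'I_m) (X : {set 'I_p}) (C : {set 'I_c}) : {set V} :=
  [set inl (k, j) | j in X] :|: [set inr l | l in C].

Lemma in_petal_inl k X C k' j :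
  (inl (k', j) \in petal k X C) = (k' == k) && (j \in X).
Proof.
rewrite inE orbC; case: imsetP => [[] //|_] /=.
apply/imsetP/andP => [[j' jX [-> ->]]|[/eqP -> jX]]; first by rewrite eqxx.
by exists j.
Qed.

Lemma in_petal_inr k X C l : (inr l \in petal k X C) = (l \in C).
Proof.
rewrite inE; case: imsetP => [[] //|_] /=.
by rewrite mem_imset // => x y [].
Qed.

Lemma card_petal k X C : #|petal k X C| = #|X| + #|C|.
Proof.
rewrite cardsU !card_imset; [|by move=> x y []|by move=> x y []].
rewrite (_ : _ :&: _ = set0) ?cards0 ?subn0 //.
apply/setP => v; rewrite !inE; apply/negP => /andP[/imsetP[j _ ->]].
by case/imsetP.
Qed.

Definition sunflower : {set {set V}} :=
  [set petal k [set: 'I_p] [set: 'I_c] | k : 'I_m].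

Definition petal_choice (i : nat) (g : {ffun 'I_m -> {set 'I_p}}) : {set V} :=
  [set v : V | match v with inl (k, j) => j \in g k | inr l => l < i end].

Lemma petal_choiceI i g k :
  petal k [set: 'I_p] [set: 'I_c] :&: petal_choice i g =
  petal k (g k) [set l : 'I_c | l < i].
Proof.
apply/setP => -[[k' j]|l]; rewrite in_setI.
  by rewrite !in_petal_inl !inE andbT; case: eqP => // ->.
by rewrite !in_petal_inr !inE.
Qed.

Lemma petal_choice_inj i : injective (petal_choice i).
Proof.
move=> g g' /setP eq; apply/ffunP => k; apply/setP => j.
by have := eq (inl (k, j)); rewrite !inE.
Qed.

Lemma num_transversals_sunflower_ge (A : set nat) (i : nat) : i <= c ->
  fcount p i A ^ m <= num_transversals A sunflower.
Proof.
move=> ic; rewrite -[p in fcount p]card_ord -cardsT -card_subsets_fcount.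
rewrite -[m in _ ^ m]card_ord -card_ffun_on.
rewrite -(card_imset _ (@petal_choice_inj i)); apply: subset_leq_card.
apply/subsetP => _ /imsetP[g /ffun_onP gA ->]; rewrite inE.
apply/forall_inP => _ /imsetP[k _ ->]; rewrite petal_choiceI card_petal.
have := gA k; rewrite inE => /andP[_]; congr (_ + _ \in A).
(* Here [i <= c] ensures that the core really supplies [i] selected vertices. *)
by rewrite -sum1dep_card -(big_ord_widen _ (fun=> 1)) // sum1_card card_ord.
Qed.

End Sunflower.

Lemma max_transversals_ge (r p i m n : nat) (A : set nat) :
  0 < p <= r -> i <= r - p -> 0 < m -> m * p + (r - p) <= n ->
  fcount p i A ^ m <= max_transversals r A n.
Proof.
move=> /andP[p0 pr] ic m0 mn.
apply: leq_trans (@num_transversals_sunflower_ge m p _ A i ic) _.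
apply: num_transversals_le_max.
- apply/forall_inP => _ /imsetP[k _ ->].
  by rewrite card_petal !cardsT !card_ord subnKC.
- move=> v; rewrite negb_forall_in.
  pose k := if v is inl (k, _) then k else Ordinal m0.
  apply/exists_inP; exists (petal _ _ _ k [set: 'I_p] [set: 'I_(r - p)]).
    exact: imset_f.
  rewrite negbK; case: v @k => [[k j]|l] /=.
    by rewrite in_petal_inl eqxx inE.
  by rewrite in_petal_inr inE.
- by rewrite card_sum card_prod !card_ord mn addn_gt0 muln_gt0 m0 p0.
Qed.

Local Open Scope classical_set_scope.
Local Open Scope ring_scope.

Theorem theorem4 (R : realType) (r : nat) (A : set nat) (p i : nat)
  (r_ge1 : (1 <= r)%N) (A_nonempty : A !=set0)
  (p_range : (1 <= p <= r)%N) (i_range : (i <= r - p)%N)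
  (pi_max : forall q j : nat, (1 <= q <= r)%N -> (j <= r - q)%N ->
     (fcount q j A)%:R `^ (q%:R^-1) <= (fcount p i A)%:R `^ (p%:R^-1) :> R) :
  (fun n : nat => (max_transversals r A n)%:R : R^o) =Theta_\oo
  (fun n : nat => (fcount p i A)%:R `^ (n%:R / p%:R) : R^o).
Proof.
have /andP[p0 pr] := p_range.
set F := fcount p i A in pi_max *; set M : R := F%:R `^ p%:R^-1 in pi_max.
have M0 : 0 <= M by exact: powR_ge0.
have rootK q k : (0 < q)%N -> (k%:R `^ q%:R^-1) ^+ q = k%:R :> R.
  move=> q0; rewrite -powR_mulrn ?powR_ge0 // -powRrM mulVf ?powRr1 //.
  by rewrite pnatr_eq0 -lt0n.
have FM n : F%:R `^ (n%:R / p%:R) = M ^+ n :> R.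
  by rewrite mulrC powRrM powR_mulrn.
have fcount_le q j : (1 <= q <= r)%N -> (j <= r - q)%N ->
    (fcount q j A)%:R <= M ^+ q.
  move=> q_range j_range; have /andP[q0 _] := q_range.
  by rewrite -(rootK q) // lerXn2r ?nnegrE ?powR_ge0 // pi_max.
have upper n : (max_transversals r A n)%:R <= M ^+ n.
  rewrite /max_transversals; elim/big_ind: _ => [||E /andP[Er /forallP nE]].
  - exact: exprn_ge0.
  - by move=> x y ? ?; rewrite /maxn; case: ifP.
  - by rewrite -[n in M ^+ n]card_ord (num_transversals_le _ _ _ r).
(* The factor [M ^+ r] pays for the vertices outside complete blocks; the added 1 keeps the constant
   positive when [M = 0]. *)
have lower n : (r <= n)%N -> M ^+ n <= (M ^+ r + 1) * (max_transversals r A n)%:R.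
  move=> rn; have [F0|F0] := posnP F.
    have -> : M = 0.
      by rewrite /M F0 powR0 // invr_eq0 pnatr_eq0 -lt0n.
    by rewrite expr0n gtn_eqF ?(leq_trans r_ge1) // mulr_ge0 ?ler0n //.
  have M1 : 1 <= M.
    by rewrite /M -[leLHS](powRr0 F%:R) ler_powR ?ler1n // invr_ge0 ler0n.
  (* The number of blocks that fit beside the core. It is positive since [r <= n], and fewer than
     [p] vertices remain, whence [n <= r + p * m]. *)
  pose m := ((n - (r - p)) %/ p)%N.
  have m0 : (0 < m)%N.
    by rewrite divn_gt0 // leq_subRL ?(leq_trans (leq_subr _ _) rn) // subnK.
  have mn : (m * p + (r - p) <= n)%N.
    rewrite addnC -leq_subRL ?(leq_trans (leq_subr _ _) rn) //.
    exact: leq_divM.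
  have nm : (n <= r + p * m)%N.
    have := ltn_ceil (n - (r - p)) p0; rewrite -/m mulSn => /ltnW.
    by rewrite leq_subLR addnA subnK // mulnC.
  apply: (@le_trans _ _ (M ^+ (r + p * m))); first exact: ler_weXn2l.
  rewrite exprD exprM rootK // -natrX mulrDl mul1r.
  apply: (@le_trans _ _ (M ^+ r * (max_transversals r A n)%:R)).
    by rewrite ler_wpM2l ?exprn_ge0 // ler_nat (@max_transversals_ge r p i).
  by rewrite lerDl ler0n.
rewrite eqThetaE bigThetaE eqOmegaO; split; apply/eqO_exP.
  exists 1; first exact: ltr01.
  by apply: nearW => n /=; rewrite FM mul1r !ger0_norm ?exprn_ge0 ?ler0n.
exists (M ^+ r + 1); first by rewrite ltr_wpDl ?exprn_ge0.
near=> n; rewrite /= FM !ger0_norm ?exprn_ge0 ?ler0n // lower //.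
near: n; exact: nbhs_infty_ge.
Unshelve. all: by end_near.
Qed.
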